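(* Let $G=C_p^m$ be the elementary abelian group of order $p^m$, where $p$ is an odd prime and $m$ is a positive integer, and let $D$ be a $(p^m,k,\lambda)$-SDS in $G$. Put $d=p^m-k$. If $1\le d\le m$, then: (i) if $d$ is even, $k+\lambda(p^{m-1}-1)\equiv p\pmod 8$; (ii) if $d$ is odd, $k+\lambda(p^{m-1}-1)\equiv p-1\pmod 8$ or $k+\lambda(p^{m-1}-1)\equiv p+3\pmod 8$.
   Context: $C_p$ denotes the cyclic group of order $p$. Let $G$ be a finite group of order $v$, with identity denoted $0_G$. In the integral group ring $\mathbb Z[G]$, identify a subset $U\subseteq G$ with $\sum_{u\in U}u$, and for $D=\sum_{g\in G}a_g g$ write $D^{(-1)}=\sum_{g\in G}a_g g^{-1}$. A signed subset of $G$ is an element $D=\sum_{g\in G}a_g g\in\mathbb Z[G]$ with all $a_g\in\{0,1,-1\}$; its support size is $k=|\{g\in G: a_g\neq 0\}|$. A signed subset $D$ of support size $k$ is a $(v,k,\lambda)$-signed difference set (SDS), with $\lambda\in\mathbb Z$, if $DD^{(-1)}=(k-\lambda)0_G+\lambda G$ in $\mathbb Z[G]$ (so the coefficient of the identity is $k$ and every other coefficient is $\lambda$). *)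

(* Defs.v *)
From HB Require Import structures.
From mathcomp Require Import all_boot all_order all_algebra.
From mathcomp Require Import all_fingroup all_solvable.

Set Implicit Arguments.
Unset Strict Implicit.
Unset Printing Implicit Defensive.

Import GRing.Theory.
Local Open Scope ring_scope.

(* The integral group ring Z[G], where G is the whole of gT : the function D
   is the formal sum of the terms D(g) g. This alias of {ffun gT -> int} keeps
   the additive structure, and its product is convolution rather than the
   pointwise product of {ffun gT -> int}. *)
Definition zgring (gT : finGroupType) : Type := {ffun gT -> int}.

HB.instance Definition _ (gT : finGroupType) := GRing.Zmodule.on (zgring gT).

Definition zg_elt (gT : finGroupType) (g : gT) : zgring gT :=
  [ffun h => (h == g)%:R].

Definition zg_mul (gT : finGroupType) (x y : zgring gT) : zgring gT :=
  [ffun g => \sum_(h : gT) x h * y (h^-1 * g)%g].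

Section ZgringRing.
Variable gT : finGroupType.
Implicit Types x y z : zgring gT.

Fact zg_mulA : associative (@zg_mul gT).
Proof.
move=> x y z; apply/ffunP=> g; rewrite !ffunE.
under eq_bigr => h _ do rewrite ffunE mulr_sumr.
under [RHS]eq_bigr => h _ do rewrite ffunE mulr_suml.
rewrite [RHS]exchange_big /=; apply: eq_bigr => h _.
rewrite [RHS](reindex_inj (mulgI h)) /=; apply: eq_bigr => a _.
by rewrite mulKg invMg !mulgA mulrA.
Qed.

Fact zg_mul1 : left_id (zg_elt 1%g) (@zg_mul gT).
Proof.
move=> x; apply/ffunP=> g; rewrite ffunE (bigD1 1%g) //= ffunE eqxx mul1r.
rewrite invg1 mul1g big1 ?addr0 // => h /negPf h1.
by rewrite ffunE h1 mul0r.
Qed.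

Fact zg_mulr1 : right_id (zg_elt 1%g) (@zg_mul gT).
Proof.
move=> x; apply/ffunP=> g; rewrite ffunE (bigD1 g) //= ffunE mulVg eqxx mulr1.
rewrite big1 ?addr0 // => h /negPf hg.
by rewrite ffunE -eq_mulVg1 hg mulr0.
Qed.

Fact zg_mulDl : left_distributive (@zg_mul gT) +%R.
Proof.
move=> x y z; apply/ffunP=> g; rewrite !ffunE -big_split /=.
by apply: eq_bigr => h _; rewrite ffunE mulrDl.
Qed.

Fact zg_mulDr : right_distributive (@zg_mul gT) +%R.
Proof.
move=> x y z; apply/ffunP=> g; rewrite !ffunE -big_split /=.
by apply: eq_bigr => h _; rewrite ffunE mulrDr.
Qed.

Fact zg_one_neq0 : zg_elt 1%g != 0 :> zgring gT.
Proof. by apply/eqP=> /ffunP/(_ 1%g); rewrite !ffunE eqxx. Qed.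

HB.instance Definition _ := GRing.Zmodule_isNzRing.Build (zgring gT)
  zg_mulA zg_mul1 zg_mulr1 zg_mulDl zg_mulDr zg_one_neq0.

End ZgringRing.

Definition zg_set (gT : finGroupType) (U : {set gT}) : zgring gT :=
  \sum_(u in U) zg_elt u.

Definition zg_inv (gT : finGroupType) (D : zgring gT) : zgring gT :=
  \sum_(g : gT) zg_elt g^-1%g *~ D g.

Definition signed_subset (gT : finGroupType) (D : zgring gT) : Prop :=
  forall g : gT, D g \in [:: 0; 1; -1].

Definition support_size (gT : finGroupType) (D : zgring gT) : nat :=
  #|[set g : gT | D g != 0]|.

Definition is_SDS (gT : finGroupType) (v k : nat) (lambda : int)
    (D : zgring gT) : Prop :=
  [/\ #|gT| = v, signed_subset D, support_size D = k
    & D * zg_inv D = (k%:Z - lambda)%:~R + zg_set [set: gT] *~ lambda].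

Section Coefficients.
Variable gT : finGroupType.
Implicit Types (D : zgring gT) (U : {set gT}) (g h : gT).

Lemma zg_coefMz D (n : int) g : (D *~ n) g = D g * n.
Proof.
have nat_coef i : (D *+ i) g = D g * i%:Z.
  elim: i => [|i IHi]; first by rewrite mulr0n mulr0 ffunE.
  by rewrite mulrS ffunE IHi intS mulrDr mulr1.
by case: n => n; [exact: nat_coef | rewrite NegzE mulrNz ffunE nat_coef mulrN].
Qed.

Lemma zg_coef_one g : (1 : zgring gT) g = (g == 1%g)%:R.
Proof. by rewrite ffunE. Qed.

Lemma zg_coef_set U g : zg_set U g = (g \in U)%:R.
Proof.
rewrite sum_ffunE; case: (boolP (g \in U)) => gU.
  rewrite (bigD1 g) //= ffunE eqxx big1 ?addr0 // => h /andP[_ /negPf hg].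
  by rewrite ffunE eq_sym hg.
rewrite big1 // => h hU; rewrite ffunE; case: eqP => // gh.
by rewrite gh hU in gU.
Qed.

Lemma zg_coef_inv D g : zg_inv D g = D g^-1%g.
Proof.
rewrite sum_ffunE (bigD1 g^-1%g) //= zg_coefMz ffunE invgK eqxx mul1r.
rewrite big1 ?addr0 // => h /negPf hg; rewrite zg_coefMz ffunE.
by rewrite -[g]invgK (inj_eq invg_inj) eq_sym hg mul0r.
Qed.

Lemma zg_eltM g h : zg_elt (g * h)%g = zg_elt g * zg_elt h.
Proof.
apply/ffunP=> a; rewrite !ffunE (bigD1 g) //= !ffunE eqxx mul1r.
rewrite big1 ?addr0; first by rewrite -(inj_eq (mulgI g^-1%g)) mulKg.
by move=> b /negPf bg; rewrite ffunE bg mul0r.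
Qed.

End Coefficients.

(* Main.v *)
Require Import Defs.
From HB Require Import structures.
From mathcomp Require Import all_boot all_order all_algebra.
From mathcomp Require Import all_fingroup all_solvable.
From mathcomp Require Import zify ring.

Import GRing.Theory.
Local Open Scope ring_scope.

(** Projecting [D] onto a quotient of order [p] turns the difference set
    equation into a statement about squares.  Let [H] be a subgroup of index
    [p], and for a coset [C] of [H] let [b_C] be the sum of the coefficients of
    [D] over [C].  Summing the coefficients of [D * zg_inv D] over [H] gives

      sum over C of b_C ^ 2 = (k - lambda) + lambda * p ^ (m - 1),

    which is [k + lambda * (p ^ (m - 1) - 1)] ([sum_sqr_rcosets]).  Modulo 8
    the square of an odd integer is 1 and that of an even one is 0 or 4.  Since
    the nonzero coefficients are odd and [H] has odd order, [b_C] is odd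
    exactly when [C] contains an even number of zeros of [D]
    ([odd_signed_sum]).

    It remains to choose [H] so that as few cosets as possible contain an odd
    number of zeros.  Group the [d] zeros into pairs, with one left over if [d]
    is odd.  If [H] contains the quotient [x * y^-1] of each pair, then [x] and
    [y] lie in the same coset, so all cosets have an even number of zeros,
    except the coset of the left-over zero when [d] is odd ([pairing_set]).
    Only [d./2 < m] elements have to be put in [H], and these cannot generate a
    group of rank [m], so some maximal subgroup contains them all
    ([abelem_small_set_maximal]).  For even [d] the sum above is then congruent
    to [p]; for odd [d] one odd square is replaced by an even one, which gives
    [p - 1] or [p + 3]. *)

Lemma odd_sqrz_mod8 (b : int) : odd `|b| -> (8 %| b ^+ 2 - 1)%Z.
Proof.
move=> ob; have [c ->] : exists c : int, b = 2 * c + 1.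
  by exists (b %/ 2)%Z; lia.
(* One of the consecutive integers [c] and [c + 1] is even. *)
have [e [->|->]] : exists e : int, c = 2 * e \/ c = 2 * e + 1.
- by exists (c %/ 2)%Z; lia.
- by apply/dvdzP; exists (e * (2 * e + 1)); ring.
- by apply/dvdzP; exists ((2 * e + 1) * (e + 1)); ring.
Qed.

Lemma even_sqrz_mod8 {b : int} :
  ~~ odd `|b| -> (8 %| b ^+ 2)%Z \/ (8 %| b ^+ 2 - 4)%Z.
Proof.
move=> eb; have [c [->|->]] : exists c : int, b = 4 * c \/ b = 4 * c + 2.
- by exists (b %/ 4)%Z; lia.
- by left; apply/dvdzP; exists (2 * c ^+ 2); ring.
- by right; apply/dvdzP; exists (2 * c * (c + 1)); ring.
Qed.

Lemma sum_odd_sqr_mod8 (T : finType) (A : {set T}) (b : T -> int) :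
  (forall i, i \in A -> odd `|b i|) ->
  (8 %| \sum_(i in A) b i ^+ 2 - #|A|%:Z)%Z.
Proof.
move=> oddA; rewrite -sum1_card -natz natr_sum -sumrB.
by apply: rpred_sum => i /oddA; apply: odd_sqrz_mod8.
Qed.

Section SignedSums.
Variable gT : finGroupType.
Implicit Types (D : zgring gT) (C : {set gT}) (H : {group gT}).

(** For [x] in [{0, 1, -1}], [x] and the indicator of [x != 0] differ by an
    even number. *)
Lemma odd_signed_sum {D} C : signed_subset D ->
  odd `|\sum_(g in C) D g| = odd #|[set g in C | D g != 0]|.
Proof.
move=> sD.
have card_sum (P : pred gT) :
    #|[set g in C | P g]|%:Z = \sum_(g in C) (P g)%:R :> int.
  rewrite -natz -sum1_card natr_sum.
  under eq_bigl => g do rewrite inE.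
  by rewrite big_mkcondr; apply: eq_bigr => g _; case: (P g).
have -> : \sum_(g in C) D g =
    #|[set g in C | D g != 0]|%:Z - 2 * #|[set g in C | D g == -1]|%:Z.
  rewrite !card_sum mulr_sumr -sumrB; apply: eq_bigr => g _.
  by have := sD g; rewrite !inE => /or3P[] /eqP->.
lia.
Qed.

Lemma sum_rcoset_product D {H C} : C \in rcosets H [set: gT] ->
  \sum_(h in C) \sum_(t in H) D h * D (t^-1 * h)%g = (\sum_(h in C) D h) ^+ 2.
Proof.
case/rcosetsP => x _ ->; rewrite expr2 mulr_suml.
apply: eq_bigr => h; rewrite mem_rcoset => hx; rewrite -mulr_sumr; congr (_ * _).
rewrite [RHS](reindex_inj (h := fun t => t^-1 * h)%g) /=; last first.
  by move=> s t /mulIg/invg_inj.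
apply: eq_bigl => t.
by rewrite mem_rcoset -mulgA groupMr // groupV.
Qed.

(** Both sides sum [D h * D h'] over the pairs [(h, h')] lying in a common right
    coset, the right-hand side through [t = h * h'^-1], which ranges over [H].
    For normal [H] this compares the coefficients of the identity after
    projecting [D * zg_inv D] to the group ring of the quotient. *)
Lemma sum_sqr_rcosets D H :
  \sum_(C in rcosets H [set: gT]) (\sum_(g in C) D g) ^+ 2
  = \sum_(t in H) (D * zg_inv D) t.
Proof.
under eq_bigr => C HC do rewrite -(sum_rcoset_product _ HC).
rewrite -(set_partition_big _ (rcosets_partition (subsetT H))).
rewrite exchange_big /=; apply: eq_bigr => t _.
rewrite ffunE; apply: eq_big => h; rewrite ?inE // => _.
by rewrite zg_coef_inv invMg invgK.
Qed.

Lemma sum_SDS_group {v k lambda D} H : is_SDS v k lambda D ->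
  \sum_(t in H) (D * zg_inv D) t = k%:Z + lambda * (#|H|%:Z - 1).
Proof.
case=> _ _ _ ->.
under eq_bigr => t _ do rewrite ffunE !zg_coefMz zg_coef_one zg_coef_set inE mul1r.
rewrite big_split /= (bigD1 1%g) //= eqxx mul1r big1 => [|t /andP[_ /negPf->]];
  last by rewrite mul0r.
by rewrite sumr_const -mulr_natr natz; ring.
Qed.

(** [B] holds the quotients [x * y^-1] of consecutive pairs of entries of [s]:
    once they are in [H], the entries of a pair always fall in the same coset
    and cancel modulo 2.  [z] is the entry left over when [s] has odd size. *)
Lemma pairing_set (s : seq gT) : exists (B : {set gT}) (z : gT),
  (#|B| <= (size s)./2)%N /\
  forall H, B \subset H -> forall a,
    odd (count (mem (H :* a)%g) s) = odd (size s) && (z \in (H :* a)%g).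
Proof.
have [n] := ubnP (size s); elim: n s => // n IHn [|x [|y s]] /= lt_n.
- by exists set0, 1%g; rewrite cards0.
- by exists set0, x; rewrite cards0; split=> // H _ a; rewrite addn0 oddb.
have [|B [z [leB evB]]] := IHn s; first by lia.
exists ((x * y^-1)%g |: B), z; split; first by rewrite cardsU1; lia.
move=> H; rewrite subUset sub1set => /andP[Hxy sBH] a.
have -> : (x \in (H :* a)%g) = (y \in (H :* a)%g).
  by rewrite !mem_rcoset -(groupMl (y * a^-1)%g Hxy) mulgA mulgKV.
by rewrite !oddD addbA addbb evB // negbK.
Qed.

End SignedSums.

(** An elementary abelian group of order [p ^ m] cannot be generated by fewer
    than [m] elements, so [B] generates a proper subgroup. *)
Lemma abelem_small_set_maximal {gT : finGroupType} {p : nat}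
    {G : {group gT}} {B : {set gT}} :
  p.-abelem%g G -> B \subset G -> (#|B| < logn p #|G|)%N ->
  exists2 H : {group gT}, maximal H G & B \subset H.
Proof.
move=> abG sBG ltB; have sgG : <<B>>%g \subset G by rewrite gen_subG.
have [eqG | [H maxH sBH]] := maximal_exists sgG.
  have := grank_min B; have -> : <<B>>%g = G by rewrite -eqG.
  by rewrite grank_abelian ?(abelem_abelian abG) // (rank_abelem abG) leqNgt ltB.
by exists H => //; apply: subset_trans sBH; apply: subset_gen.
Qed.

Theorem theorem4p7 (p m : nat) (p_prime : prime p) (p_odd : odd p)
    (m_gt0 : (0 < m)%N)
    (gT : finGroupType) (gT_abelem : p.-abelem%g [set: gT])
    (gT_card : #|gT| = (p ^ m)%N)
    (k : nat) (lambda : int) (D : zgring gT)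
    (D_SDS : is_SDS (p ^ m)%N k lambda D)
    (d : nat) (d_def : d%:Z = (p ^ m)%N%:Z - k%:Z)
    (d_bounds : (1 <= d <= m)%N) :
  (~~ odd d ->
     (k%:Z + lambda * ((p ^ m.-1)%N%:Z - 1) = p%:Z %[mod 8])%Z) /\
  (odd d ->
     (k%:Z + lambda * ((p ^ m.-1)%N%:Z - 1) = p%:Z - 1 %[mod 8])%Z \/
     (k%:Z + lambda * ((p ^ m.-1)%N%:Z - 1) = p%:Z + 3 %[mod 8])%Z).
Proof.
have [_ sD Dk _] := D_SDS.
pose Z := [set g : gT | D g == 0].
have cardZ : #|Z| = d.
  have := cardsC [set g | D g != 0]; rewrite [X in (X + _)%N]Dk gT_card.
  have -> : ~: [set g | D g != 0] = Z by apply/setP=> g; rewrite !inE negbK.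
  by lia.
have [B [z [leB evB]]] := pairing_set _ (enum Z).
rewrite -cardE cardZ in leB evB.
have [|H maxH sBH] := abelem_small_set_maximal gT_abelem (subsetT B).
  by rewrite cardsT gT_card pfactorK //; lia.
have indexH : #|[set: gT] : H|%g = p.
  exact: p_maximal_index (abelem_pgroup gT_abelem) maxH.
have cardH : #|H| = (p ^ m.-1)%N.
  apply/eqP; rewrite -(eqn_pmul2r (prime_gt0 p_prime)) -{1}indexH.
  by rewrite Lagrange ?subsetT // cardsT gT_card -expnSr prednK.
pose b (C : {set gT}) : int := \sum_(g in C) D g.
have odd_b C : C \in rcosets H [set: gT] ->
    odd `|b C| = ~~ (odd d && (z \in C)).
  case/rcosetsP=> a _ ->; rewrite odd_signed_sum // -evB //.
  have := cardsID Z (H :* a)%g; rewrite card_rcoset cardH.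
  have -> : (H :* a :\: Z)%g = [set g in (H :* a)%g | D g != 0].
    by apply/setP=> g; rewrite !inE andbC.
  have -> : #|(H :* a)%g :&: Z| = count (mem (H :* a)%g) (enum Z).
    by rewrite setIC cardE (perm_size (enum_setI _ _)) size_filter.
  have : odd (p ^ m.-1) by rewrite oddX p_odd orbT.
  by move=> + sizeE; rewrite -sizeE oddD; do 2!case: (odd _).
have -> : k%:Z + lambda * ((p ^ m.-1)%N%:Z - 1) =
    \sum_(C in rcosets H [set: gT]) b C ^+ 2.
  by rewrite -cardH -(sum_SDS_group _ H D_SDS) -sum_sqr_rcosets.
have mod8 (x y : int) : (8 %| x - y)%Z -> (x = y %[mod 8])%Z.
  by rewrite -eqz_mod_dvd => /eqP.
split=> [/negPf ev_d | odd_d].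
  apply: mod8; rewrite -indexH; apply: sum_odd_sqr_mod8 => C /odd_b->.
  by rewrite ev_d.
(* For odd [d], the coset of the left-over zero [z] is the only one on which
   [b] is even. *)
have Hz : (H :* z)%g \in rcosets H [set: gT] by apply/rcosetsP; exists z.
have even_bz : ~~ odd `|b (H :* z)%g|.
  by rewrite odd_b // odd_d rcoset_refl.
have := cardsD1 (H :* z)%g (rcosets H [set: gT]).
rewrite Hz [#|rcosets _ _|]indexH (big_setD1 _ Hz) /= => card_rest.
set rest := _ :\ _ in card_rest *.
have rest8 : (8 %| \sum_(C in rest) b C ^+ 2 - #|rest|%:Z)%Z.
  apply: sum_odd_sqr_mod8 => C; rewrite !inE => /andP[neqC HC].
  rewrite odd_b // odd_d /=; apply: contra neqC.
  by case/rcosetsP: HC => a _ -> /rcoset_eqP->.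
have := even_sqrz_mod8 even_bz; rewrite card_rest.
move: (b _ ^+ 2) (\sum_(_ in _) _) (#|_|) rest8 => x s n rest8 {card_rest}.
by case=> bz8; [left | right]; apply: mod8; lia.
Qed.
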